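(* There is an absolute constant $c>0$ such that the following holds for all reals $\lambda\geq 1$ and $d>0$. Let $G$ be a graph in which $d\leq d_G(v)\leq \lambda d$ for each $v\in V(G)$. Then, for some $d'\geq cd/\lambda^3$, $G$ contains a subgraph $H$ with average degree $d'$ and maximum degree at most $d'+10^8$ such that $|H|\geq c|G|/\lambda^{10}$.
   Context: All graphs are finite and simple with non-empty vertex sets. $|G|$ denotes the number of vertices of $G$ and $d_G(v)$ the degree of $v$ in $G$. *)

(* Defs.v *)
From HB Require Import structures.
From mathcomp Require Import all_boot all_order all_algebra.
From mathcomp Require Import reals.
Set Implicit Arguments.
Unset Strict Implicit.
Unset Printing Implicit Defensive.
Import Order.TTheory GRing.Theory Num.Theory.

(* Simple graphs with non-empty vertex set, drawn from an ambient finite type,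
   so that a graph and its (not necessarily spanning) subgraphs have the same
   type. *)
Record graph (T : finType) := Graph {
  vertices : {set T};
  adj : rel T;
  adj_sym : symmetric adj;
  adj_irrefl : irreflexive adj;
  adj_vertices : forall x y, adj x y -> x \in vertices;
  vertices_neq0 : vertices != set0
}.

Definition num_vertices (T : finType) (G : graph T) : nat := #|vertices G|.

Definition degree (T : finType) (G : graph T) (v : T) : nat :=
  #|[set w | adj G v w]|.

Definition max_degree (T : finType) (G : graph T) : nat :=
  \max_(v in vertices G) degree G v.

Definition average_degree (R : realType) (T : finType) (G : graph T) : R :=
  ((\sum_(v in vertices G) degree G v)%:R / (num_vertices G)%:R)%R.

Definition subgraph (T : finType) (H G : graph T) : Prop :=
  vertices H \subset vertices G /\ subrel (adj H) (adj G).

(* Main.v *)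
(* Let edge weights in [0, 1] be given, with weighted degrees d(v) <= D. For
   m <= D put q(v) = max(d(v), m), keep each vertex v independently with
   probability q(v) / D and multiply the weight of uv by m^2 / (q(u) q(v)).
   Every vertex with d(v) >= m then has expected weighted degree exactly
   k = m^2 / D, the others stay deficient by at most m - d(v), and the total
   variance is at most the total deficiency, since few vertices are deleted.
   Hence, up to a few l1-small errors, a typical deficiency s is replaced by one
   of order sqrt(s). Starting from all weights 1 and m = d, which gives
   k = d / lambda, and iterating with m closer and closer to D brings the average
   deficiency down to a constant. Only second moments are used, so the random
   choices can be replaced by minimising a multiaffine function. The edge weights
   are finally rounded to 0 or 1 with error at most 2 at each vertex. If
   d / lambda is bounded, a maximal matching is already large enough. *)

Require Import Defs.
From HB Require Import structures.
From mathcomp Require Import all_boot all_order all_algebra.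
From mathcomp Require Import reals zify ring lra.
Set Implicit Arguments.
Unset Strict Implicit.
Unset Printing Implicit Defensive.
Import Order.TTheory GRing.Theory Num.Theory.
Local Open Scope ring_scope.

(** * Derandomised vertex sampling *)

Section Sampling.
Variables (R : realFieldType) (T : finType).
Implicit Types (V : {set T}) (w : T -> T -> R) (z : {ffun T -> R}).

Definition upd z u t : {ffun T -> R} := [ffun v => if v == u then t else z v].

(** An affine function on [0, 1] is smallest at an end point, so the coordinates of [x] in [V] can
    be moved to 0 or 1 one after another without increasing [f]. *)
Lemma multiaffine_min (f : {ffun T -> R} -> R) V (x : {ffun T -> R}) :
    (forall z u t, f (upd z u t) = (1 - t) * f (upd z u 0) + t * f (upd z u 1)) ->
    (forall v, v \in V -> 0 <= x v <= 1) -> (forall v, v \notin V -> x v = 0) ->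
  exists2 S : {set T}, S \subset V & f [ffun v => (v \in S)%:R] <= f x.
Proof.
move=> f_aff x01 x0.
have [z [fz z01 zx]] : exists z, [/\ f z <= f x,
    forall v, v \in enum V -> (z v == 0) || (z v == 1) &
    forall v, v \notin enum V -> z v = x v].
  have: {subset enum V <= V} by move=> v; rewrite mem_enum.
  elim: (enum V) => [|u s IHs] sV; first by exists x; split.
  have [v vs|z [fz z01 zx]] := IHs; first by apply: sV; rewrite inE vs orbT.
  have [us|us] := boolP (u \in s).
    exists z; split=> // v; rewrite inE.
      by case/orP=> [/eqP->|]; exact: z01.
    by case/norP=> _; exact: zx.
  have /andP[t0 t1] : 0 <= z u <= 1 by rewrite zx // x01 // sV // mem_head.
  have updz : upd z u (z u) = z.
    by apply/ffunP=> v; rewrite ffunE; case: eqP => // ->.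
  have [b fb b01] : exists2 b, f (upd z u b) <= f z & (b == 0) || (b == 1).
    have := f_aff z u (z u); rewrite updz => fzE.
    have [le01|lt10] := leP (f (upd z u 0)) (f (upd z u 1)).
      by exists 0; rewrite ?eqxx // fzE; nra.
    by exists 1; rewrite ?eqxx ?orbT // fzE; nra.
  exists (upd z u b); split=> [|v|v]; first exact: le_trans fb fz.
    by rewrite inE ffunE; case: eqP => //= _; exact: z01.
  by rewrite inE ffunE => /norP[/negPf->]; exact: zx.
exists [set v in V | z v == 1]; first by apply/subsetP=> v; rewrite inE => /andP[].
rewrite (_ : [ffun v => _] = z) //; apply/ffunP=> v; rewrite ffunE inE.
have [vV|vV] := boolP (v \in V); last by rewrite zx ?mem_enum // x0.
by have := z01 v; rewrite mem_enum => /(_ vV) /orP[]/eqP-> /=; rewrite ?eqxx // eq_sym oner_eq0.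
Qed.

(** First moment method: the right side is the expectation of the left side when each [v] in [V] is
    kept independently with probability [x v]. Since [w v v = 0], the survival of [v] is independent
    of its weighted degree. *)
Lemma sampling V w (x mu c : T -> R) (a : R) :
    (forall v, v \in V -> 0 <= x v <= 1) -> (forall v, w v v = 0) ->
    (forall v, v \in V -> \sum_(u in V) x u * w v u = mu v) ->
  exists2 S : {set T}, S \subset V &
    \sum_(v in S) (c v + a * (\sum_(u in S) w v u - mu v) ^+ 2) <=
    \sum_(v in V) x v * (c v + a * \sum_(u in V) x u * (1 - x u) * w v u ^+ 2).
Proof.
move=> x01 w0 xmu.
(* With probabilities [z], the expected squared deviation from [mu v] is a squared bias plus a
   variance. The squares of each [z u] cancel, so [f] is multiaffine; the variance vanishes at 0-1
   points and the bias vanishes at [x]. *)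
pose f z := \sum_(v in V) z v * (c v + a * ((\sum_(u in V) z u * w v u - mu v) ^+ 2 +
               \sum_(u in V) (z u - z u ^+ 2) * w v u ^+ 2)).
pose y : {ffun T -> R} := [ffun v => if v \in V then x v else 0].
have yE v : v \in V -> y v = x v by rewrite ffunE => ->.
have [|v vV|v /negPf vV|S SV fS] := @multiaffine_min f V y.
- move=> z u t; have [uV|uV] := boolP (u \in V); last first.
    have fE s : f (upd z u s) = f z.
      have updE v : v \in V -> upd z u s v = z v.
        by move=> vV; rewrite ffunE; case: eqP => // vu; rewrite -vu vV in uV.
      apply: eq_bigr => v vV; rewrite updE //.
      by congr (_ * (_ + _ * ((_ - _) ^+ 2 + _))); apply: eq_bigr => v' v'V; rewrite updE.
    by rewrite !fE; ring.
  rewrite /f !mulr_sumr -big_split /=; apply: eq_bigr => v vV.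
  rewrite !(bigD1 u uV) /=.
  have sumE s (F : R -> T -> R) : \sum_(i in V | i != u) F (upd z u s i) i =
                        \sum_(i in V | i != u) F (z i) i.
    by apply: eq_bigr => i /andP[_ /negPf iu]; rewrite ffunE iu.
  rewrite !(sumE _ (fun s i => s * w v i)) !(sumE _ (fun s i => (s - s ^+ 2) * w v i ^+ 2)).
  set s1 := \sum_(i in V | _) _; set s2 := \sum_(i in V | _) _.
  rewrite !ffunE eqxx; have [->|_] := eqVneq v u; last by ring.
  by rewrite w0; ring.
- by rewrite yE ?x01.
- by rewrite ffunE vV.
exists S => //; move: fS; rewrite /f => fS.
apply: le_trans (le_trans fS _).
  rewrite [leRHS](big_setID S) /= (setIidPr SV) [X in _ <= _ + X]big1 ?addr0; last first.
    by move=> v /setDP[_ /negPf vS]; rewrite ffunE vS mul0r.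
  apply: ler_sum => v vS; rewrite ffunE vS mul1r lerD2l.
  rewrite [X in _ ^+ 2 + X]big1 ?addr0; last first.
    by move=> u _; rewrite ffunE; case: (u \in S); rewrite ?expr1n ?expr0n subrr mul0r.
  rewrite [X in _ <= a * (X - _) ^+ 2](big_setID S) /= (setIidPr SV).
  rewrite [X in _ <= a * (_ + X - _) ^+ 2]big1 ?addr0; last first.
    by move=> u /setDP[_ /negPf uS]; rewrite ffunE uS mul0r.
  by under [X in _ <= a * (X - _) ^+ 2]eq_bigr => u uS do rewrite ffunE uS mul1r.
apply: ler_sum => v vV; rewrite yE // -(xmu v vV).
under eq_bigr => u uV do rewrite yE //.
under [X in (_ ^+ 2 + X)]eq_bigr => u uV do rewrite yE //.
rewrite subrr expr0n /= add0r.
have xE u : x u - x u ^+ 2 = x u * (1 - x u) by ring.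
by under [X in a * X]eq_bigr => u uV do rewrite xE.
Qed.

Lemma weighted_cauchy_schwarz V (a b : T -> R) : (forall u, u \in V -> 0 <= b u) ->
  (\sum_(u in V) a u * b u) ^+ 2 <= (\sum_(u in V) b u) * \sum_(u in V) a u ^+ 2 * b u.
Proof.
move=> b0; set S := \sum_(u in V) a u * b u; set B := \sum_(u in V) b u.
set Q := \sum_(u in V) _.
have B0 : 0 <= B by apply: sumr_ge0.
have [B1|/eqP B1] := eqVneq B 0.
  rewrite (_ : S = 0) ?B1 ?mul0r ?expr0n //; apply: big1 => u uV.
  by have := psumr_eq0P b0 B1 => ->; rewrite ?mulr0.
have: 0 <= \sum_(u in V) b u * (a u * B - S) ^+ 2.
  by apply: sumr_ge0 => u uV; rewrite mulr_ge0 ?b0 // sqr_ge0.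
have -> : \sum_(u in V) b u * (a u * B - S) ^+ 2 = B * (B * Q - S ^+ 2).
  transitivity (\sum_(u in V) (B ^+ 2 * (a u ^+ 2 * b u) - 2 * B * S * (a u * b u) +
                               S ^+ 2 * b u)).
    by apply: eq_bigr => u _; ring.
  by rewrite big_split sumrB /= -!mulr_sumr -/S -/Q -/B; ring.
by rewrite pmulr_rge0 ?subr_ge0 // lt_neqAle B0 andbT eq_sym; apply/eqP.
Qed.

End Sampling.

(** * One regularizing step for edge weights *)

Section FractionalSubgraphs.
Variables (R : realFieldType) (T : finType) (G : graph T).
Implicit Types (V : {set T}) (w : T -> T -> R) (k : R).

Definition fractional w :=
  [/\ forall u v, w u v = w v u, forall u v, 0 <= w u v <= 1
    & forall u v, ~~ adj G u v -> w u v = 0].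

Definition wdegree V w v := \sum_(u in V) w v u.

(* The deficiency [k - wdegree V w v] is split into a part [a] controlled in
   l2 and a part [b] controlled in l1. *)
Definition nearly_regular V w k (a b : T -> R) :=
  [/\ fractional w, forall v, v \in V -> wdegree V w v <= k,
      forall v, v \in V -> 0 <= b v
    & forall v, v \in V -> k - wdegree V w v <= a v + b v].

(** Scaling the weight of [uv] by [g u * g v] brings every weighted degree down to at most [k]. The
    scaling of its neighbours costs [v] a further [g v * l v]; by Cauchy-Schwarz and double
    counting, these losses are bounded in l2 by the positive part of [xi]. The negative part of [xi]
    also enters [a], and the square of a sum of two terms gives the factor 2. *)
Lemma truncate_excess V w k (xi b : T -> R) : 0 < k -> fractional w ->
    (forall v, v \in V -> 0 <= b v) ->
    (forall v, v \in V -> wdegree V w v = k - b v + xi v) ->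
  exists w' a, nearly_regular V w' k a b /\
    \sum_(v in V) a v ^+ 2 <= 2 * \sum_(v in V) xi v ^+ 2.
Proof.
move=> k0 [w_sym w01 w_adj] b0 degE.
have w0 u v : 0 <= w u v by case/andP: (w01 u v).
have deg0 v : 0 <= wdegree V w v by apply: sumr_ge0.
pose M v := Num.max k (wdegree V w v).
have kM v : k <= M v by rewrite le_max lexx.
have degM v : wdegree V w v <= M v by rewrite le_max lexx orbT.
have M0 v : 0 < M v by apply: lt_le_trans (kM v).
pose g v := k / M v.
have gM v : g v * M v = k by rewrite /g divfK // gt_eqF.
have g0 v : 0 <= g v by rewrite divr_ge0 // ltW.
have g1 v : g v <= 1 by rewrite ler_pdivrMr ?mul1r.
pose l v := \sum_(u in V) (1 - g u) * w v u.
pose w' u v := w u v * (g u * g v).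
have gg0 u v : 0 <= g u * g v <= 1.
  by rewrite mulr_ge0 //= mulr_ile1.
have deg'E v : wdegree V w' v = g v * (wdegree V w v - l v).
  rewrite /wdegree /l -sumrB mulr_sumr; apply: eq_bigr => u _.
  by rewrite /w'; ring.
have l0 v : 0 <= l v by apply: sumr_ge0 => u _; rewrite mulr_ge0 // subr_ge0.
exists w', (fun v => Num.max 0 (- xi v) + g v * l v); split.
  split=> // [|v vV|v vV].
  - split=> [u v|u v|u v uv]; rewrite /w'.
    + by rewrite w_sym [g u * _]mulrC.
    + have /andP[? ?] := w01 u v; have /andP[? ?] := gg0 u v.
      by rewrite mulr_ge0 //= mulr_ile1.
    + by rewrite w_adj ?mul0r.
  - rewrite deg'E -(gM v); apply: ler_wpM2l => //.
    by have := l0 v; have := degM v; lra.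
  - rewrite deg'E mulrBr.
    have : k - g v * wdegree V w v <= Num.max 0 (- xi v) + b v.
      have bv := b0 v vV; have := degE v vV.
      have : k - g v * wdegree V w v <= M v - wdegree V w v.
        by rewrite -{1}(gM v); have := g1 v; have := degM v; nra.
      rewrite /M; case: (leP k (wdegree V w v)) => ?; case: (leP 0 (- xi v)) => ?; lra.
    lra.
have boundl v : (g v * l v) ^+ 2 <= k * \sum_(u in V) (1 - g u) ^+ 2 * w v u.
  have CS := @weighted_cauchy_schwarz R T V (fun u => 1 - g u) (w v) (fun u _ => w0 v u).
  rewrite exprMn; apply: le_trans (ler_wpM2l (sqr_ge0 _) CS) _.
  rewrite mulrA; apply: ler_wpM2r.
    by apply: sumr_ge0 => u _; rewrite mulr_ge0 ?sqr_ge0.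
  have : g v * wdegree V w v <= k by rewrite -(gM v) ler_wpM2l.
  by rewrite /wdegree; have := g0 v; have := g1 v; nra.
have suml : \sum_(v in V) (g v * l v) ^+ 2 <= \sum_(v in V) (Num.max 0 (xi v)) ^+ 2.
  apply: le_trans (ler_sum _ (fun v _ => boundl v)) _.
  rewrite -mulr_sumr exchange_big /= mulr_sumr; apply: ler_sum => u uV.
  under eq_bigr => v _ do rewrite w_sym.
  rewrite -mulr_sumr -/(wdegree V w u).
  have -> : 1 - g u = (M u - k) / M u by rewrite /g mulrBl divff ?gt_eqF.
  have Mk : M u - k <= Num.max 0 (xi u).
    have := b0 u uV; have := degE u uV; rewrite /M.
    by case: (leP k (wdegree V w u)) => ?; case: (leP 0 (xi u)) => ?; lra.
  apply: (@le_trans _ _ ((M u - k) ^+ 2)); last first.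
    by rewrite ler_sqr ?nnegrE ?subr_ge0 // le_max lexx.
  rewrite exprMn mulrCA -[leRHS]mulr1 -mulrA; apply: ler_wpM2l; first exact: sqr_ge0.
  rewrite exprVn mulrA [_ * k]mulrC mulrAC ler_pdivrMr ?exprn_gt0 // mul1r expr2.
  by rewrite ler_pM // ltW.
have -> : \sum_(v in V) xi v ^+ 2 =
    \sum_(v in V) Num.max 0 (xi v) ^+ 2 + \sum_(v in V) Num.max 0 (- xi v) ^+ 2.
  rewrite -big_split; apply: eq_bigr => v _ /=.
  by case: (leP 0 (xi v)); case: (leP 0 (- xi v)) => h1 h2; rewrite ?expr0n /=; nra.
apply: (@le_trans _ _ (2 * (\sum_(v in V) (g v * l v) ^+ 2 +
                            \sum_(v in V) Num.max 0 (- xi v) ^+ 2))).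
  rewrite -big_split mulr_sumr; apply: ler_sum => v _ /=.
  by have := sqr_ge0 (Num.max 0 (- xi v) - g v * l v); lra.
by rewrite ler_pM2l // lerD2r.
Qed.

(** Vertices are kept with probability [x v]. The deficiency of the expected degree goes into [b],
    the random deviation into [a]. The number [c] is a charge per kept vertex; a negative [c]
    rewards survival. *)
Lemma regularizing_step V w (D m c lam : R) : fractional w -> 0 < m <= D -> 0 <= lam ->
    (forall v, v \in V -> wdegree V w v <= D) ->
  let k := m ^+ 2 / D in
  let x v := Num.max (wdegree V w v) m / D in
  exists V' w' a b, [/\ V' \subset V, nearly_regular V' w' k a b &
    \sum_(v in V') (c + b v) + lam * \sum_(v in V') a v ^+ 2 <=
    \sum_(v in V) x v * (c + Num.max 0 (m - wdegree V w v)) +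
    2 * lam * k * \sum_(v in V) x v * (1 - x v)].
Proof.
move=> [w_sym w01 w_adj] /andP[m0 mD] lam0 degD k x.
have D0 : 0 < D by apply: lt_le_trans mD.
have w0 u v : 0 <= w u v by case/andP: (w01 u v).
have deg0 v : 0 <= wdegree V w v by apply: sumr_ge0.
pose q v := Num.max (wdegree V w v) m.
have mq v : m <= q v by rewrite le_max lexx orbT.
have degq v : wdegree V w v <= q v by rewrite le_max lexx.
have q0 v : 0 < q v by apply: lt_le_trans (mq v).
have qN0 v : q v != 0 by rewrite gt_eqF.
have DN0 : D != 0 by rewrite gt_eqF.
have qD v : v \in V -> q v <= D by move=> vV; rewrite ge_max degD.
have xE v : x v = q v / D by [].
have x0 v : 0 <= x v by rewrite xE divr_ge0 // ltW // (lt_le_trans m0).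
have x1 v : v \in V -> x v <= 1 by move=> vV; rewrite ler_pdivrMr // mul1r qD.
have k0 : 0 < k by rewrite divr_gt0 // exprn_gt0.
pose p u v := m ^+ 2 / (q u * q v).
have p01 u v : 0 <= p u v <= 1.
  have qq0 : 0 < q u * q v by rewrite mulr_gt0.
  rewrite divr_ge0 ?sqr_ge0 ?(ltW qq0) //= ler_pdivrMr // mul1r expr2.
  by rewrite ler_pM // ltW.
pose w' u v := w u v * p u v.
have w'_frac : fractional w'.
  split=> [u v|u v|u v uv]; rewrite /w'.
  - by rewrite w_sym /p [q u * _]mulrC.
  - have /andP[? ?] := w01 u v; have /andP[? ?] := p01 u v.
    by rewrite mulr_ge0 //= mulr_ile1.
  - by rewrite w_adj ?mul0r.
have [w'_sym w'01 _] := w'_frac.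
pose mu v := k * (wdegree V w v / q v).
have xmu v : \sum_(u in V) x u * w' v u = mu v.
  rewrite /mu /wdegree mulr_suml mulr_sumr; apply: eq_bigr => u _.
  rewrite xE /w' /p /k; field.
  by rewrite qN0 DN0 qN0.
have degq1 v : 0 <= wdegree V w v / q v <= 1.
  by rewrite divr_ge0 ?(ltW (q0 v)) //= ler_pdivrMr // mul1r.
pose b v := k - mu v.
have b0 v : 0 <= b v by rewrite /b /mu; have := degq1 v; nra.
have bm v : b v <= Num.max 0 (m - wdegree V w v).
  have -> : b v = k / q v * (q v - wdegree V w v) by rewrite /b /mu; field.
  have kq : k / q v <= 1.
    rewrite ler_pdivrMr // mul1r (le_trans _ (mq v)) // ler_pdivrMr // expr2.
    by rewrite ler_pM // ltW.
  have kq0 : 0 <= k / q v by rewrite divr_ge0 // ltW.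
  have -> : Num.max 0 (m - wdegree V w v) = q v - wdegree V w v.
    by rewrite /q; case: (leP (wdegree V w v) m) => ?; case: (leP 0 (m - wdegree V w v)) => ?; lra.
  by have := degq v; nra.
have xV v : v \in V -> 0 <= x v <= 1 by move=> vV; rewrite x0 x1.
have w'0 v : w' v v = 0 by rewrite /w' w_adj ?mul0r // adj_irrefl.
(* The coefficient [2 * lam] pays for the factor 2 in [truncate_excess]. *)
have [V' V'V] := @sampling R T V w' x mu (fun v => c + b v) (2 * lam) xV w'0 (fun v _ => xmu v).
move=> sumV'.
pose xi v := wdegree V' w' v - mu v.
have [||w'' [a [near_reg suma]]] := @truncate_excess V' w' k xi b k0 w'_frac.
- by move=> v _; exact: b0.
- by move=> v _; rewrite /xi /b; ring.
exists V', w'', a, b; split=> //.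
apply: (@le_trans _ _ (\sum_(v in V') (c + b v + 2 * lam * (\sum_(u in V') w' v u - mu v) ^+ 2))).
  rewrite [leRHS]big_split /= lerD2l -mulr_sumr (mulrC 2) -mulrA.
  exact: ler_wpM2l.
apply: le_trans sumV' _.
under eq_bigr => v _ do rewrite mulrDr.
rewrite big_split; apply: lerD.
  by apply: ler_sum => v vV; apply: ler_wpM2l => //; rewrite lerD2l.
under eq_bigr => v _ do rewrite mulrCA.
rewrite -mulr_sumr -[leRHS]mulrA; apply: ler_wpM2l; first by rewrite mulr_ge0.
(* Weights are at most 1, so their squares can be replaced by the weights; swapping the sums then
   produces the expected degrees [mu u], which are at most [k]. *)
apply: (@le_trans _ _ (\sum_(v in V) x v * \sum_(u in V) x u * (1 - x u) * w' v u)).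
  apply: ler_sum => v vV; apply: ler_wpM2l => //; apply: ler_sum => u uV.
  have /andP[? ?] := w'01 v u; apply: ler_wpM2l; last by nra.
  by rewrite mulr_ge0 // subr_ge0 x1.
under eq_bigr => v _ do rewrite mulr_sumr.
rewrite exchange_big /= mulr_sumr; apply: ler_sum => u uV.
under eq_bigr => v _ do rewrite mulrCA w'_sym.
rewrite -mulr_sumr xmu mulrC; apply: ler_wpM2r.
  by rewrite mulr_ge0 // subr_ge0 x1.
by rewrite /mu; have := degq1 u; nra.
Qed.

End FractionalSubgraphs.

(** * Halving the scale of the deficiency *)

Section Iteration.
Variables (R : realFieldType) (T : finType) (G : graph T).
Implicit Types (V : {set T}) (w : T -> T -> R) (k rho M K : R).

(* [rho] is the current scale of the l2 part of the deficiency.  As [rho] is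
   halved, the increments of [14 * 10 ^+ 3 / rho] pay for the new deficiency and for
   the lost vertices. *)
Definition at_scale rho M K V w k a b :=
  [/\ nearly_regular G V w k a b, K / 2 + rho ^+ 2 <= k, #|V|%:R <= M
    & \sum_(v in V) (b v + a v ^+ 2 / rho ^+ 2) + 160 * (M - #|V|%:R) <=
      (40 + 14 * 10 ^+ 3 / rho) * M].

(** With [y = a v / rho], the inequality [y <= y ^+ 2 + 1 / 4] turns the l2 part into an l1
    bound. *)
Lemma sum_deficiency_le V w k a b rho : 1 <= rho -> nearly_regular G V w k a b ->
  \sum_(v in V) (k - wdegree V w v) <=
  rho * (\sum_(v in V) (b v + a v ^+ 2 / rho ^+ 2) + #|V|%:R / 4).
Proof.
move=> rho1 [_ _ b0 def].
have -> : #|V|%:R / 4 = \sum_(v in V) (1 / 4 : R).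
  by rewrite sumr_const -[RHS]mulr_natl mul1r.
rewrite -big_split mulr_sumr; apply: ler_sum => v vV /=.
have := def v vV; have := b0 v vV.
have rhoN0 : rho != 0 by apply: lt0r_neq0; lra.
set y := a v / rho; have -> : a v = rho * y by rewrite /y; field.
have -> : (rho * y) ^+ 2 / rho ^+ 2 = y ^+ 2 by field.
have : 0 <= (y - 1 / 2) ^+ 2 by exact: sqr_ge0.
by nra.
Qed.

Lemma halve_scale rho M K V w k a b : 10 ^+ 3 <= rho -> 0 <= K -> 0 <= M ->
    at_scale rho M K V w k a b ->
  exists V' w' k' a' b', V' \subset V /\ at_scale (rho / 2) M K V' w' k' a' b'.
Proof.
move=> rho1000 K0 M0 [near kD Vn0 pot].
have rho1 : 1 <= rho by lra.
have rho0 : 0 < rho by lra.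
have sumS := sum_deficiency_le rho1 near.
have [w_frac degk b0 def] := near.
have rho20 : 0 < rho ^+ 2 by rewrite exprn_gt0.
have k0 : 0 < k by lra.
(* The new target [m ^+ 2 / k] is at least [k - rho ^+ 2 / 2], which is what the invariant allows
   [k] to lose. *)
pose m := k - rho ^+ 2 / 4.
have m0 : 0 < m <= k by rewrite /m; apply/andP; split; lra.
have lam0 : 0 <= 4 / rho ^+ 2 by rewrite divr_ge0 // ltW.
(* The charge [-160] matches the weight of lost vertices in [at_scale], and [4 / rho ^+ 2] is the l2
   weight at scale [rho / 2]. *)
have [V' [w' [a' [b' [V'V near' sum']]]]] := regularizing_step (-160) w_frac m0 lam0 degk.
exists V', w', (m ^+ 2 / k), a', b'; split=> //.
set Phi := \sum_(v in V) (b v + _) in sumS pot.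
set S := \sum_(v in V) (k - _) in sumS.
set n : R := #|V|%:R in sumS Vn0 pot.
pose x v := Num.max (wdegree V w v) m / k.
have k'k : m ^+ 2 / k <= k by rewrite ler_pdivrMr // expr2; case/andP: m0; nra.
have k'0 : 0 <= m ^+ 2 / k by rewrite divr_ge0 ?sqr_ge0 // ltW.
have x1S v : v \in V -> 0 <= 1 - x v <= (k - wdegree V w v) / k.
  move=> vV; have := degk v vV; have /andP[_ ?] := m0 => ?.
  have -> : 1 - x v = (k - Num.max (wdegree V w v) m) / k.
    by rewrite /x mulrBl divff ?gt_eqF.
  rewrite divr_ge0 ?(ltW k0) //=; last by rewrite subr_ge0 ge_max; apply/andP.
  by rewrite ler_pM2r ?invr_gt0 // lerD2l lerN2 le_max lexx.
have x0 v : v \in V -> 0 <= x v.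
  move=> vV; rewrite /x divr_ge0 ?(ltW k0) // le_max; apply/orP; right.
  by case/andP: m0 => ? _; exact: ltW.
have sum1x : \sum_(v in V) (1 - x v) <= S / k.
  by rewrite mulr_suml; apply: ler_sum => v /x1S /andP[].
(* The gap [rho ^+ 2 / 4] between [k] and [m] is just enough for [rho * y - rho ^+ 2 / 4 <= y ^+ 2],
   so the old potential pays for the new [b']. *)
have excess v : v \in V -> Num.max 0 (m - wdegree V w v) <= b v + a v ^+ 2 / rho ^+ 2.
  move=> vV; have := def v vV; have := b0 v vV; rewrite /m.
  have rhoN0 : rho != 0 by rewrite gt_eqF.
  set y := a v / rho; have -> : a v = rho * y by rewrite /y; field.
  have -> : (rho * y) ^+ 2 / rho ^+ 2 = y ^+ 2 by field.
  have : 0 <= (y - rho / 2) ^+ 2 by exact: sqr_ge0.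
  have : 0 <= y ^+ 2 by exact: sqr_ge0.
  by move=> ? ? ? ?; rewrite ge_max; apply/andP; split; lra.
have rhs : \sum_(v in V) x v * (- 160 + Num.max 0 (m - wdegree V w v)) <=
           Phi - 160 * n + 160 * (S / k).
  apply: (@le_trans _ _ (\sum_(v in V) (b v + a v ^+ 2 / rho ^+ 2 - 160 * 1 + 160 * (1 - x v)))).
    apply: ler_sum => v vV; have := excess v vV; have := x0 v vV; have /andP[] := x1S v vV.
    have : 0 <= Num.max 0 (m - wdegree V w v) by rewrite le_max lexx.
    by nra.
  rewrite big_split sumrB /= -!mulr_sumr sumr_const -/n -/Phi.
  by have := sum1x; lra.
have var : 2 * (4 / rho ^+ 2) * (m ^+ 2 / k) * \sum_(v in V) x v * (1 - x v) <=
           8 * (S / rho ^+ 2).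
  have : \sum_(v in V) x v * (1 - x v) <= S / k.
    apply: le_trans sum1x; apply: ler_sum => v vV.
    by have /andP[] := x1S v vV; nra.
  have : 0 <= \sum_(v in V) x v * (1 - x v).
    by apply: sumr_ge0 => v vV; rewrite mulr_ge0 ?x0 //; have /andP[] := x1S v vV.
  set Q := \sum_(v in V) _ => Q0 QS.
  have kQ : m ^+ 2 / k * Q <= S.
    apply: (@le_trans _ _ (k * Q)); first exact: ler_wpM2r.
    by rewrite -ler_pdivlMl // mulrC.
  rewrite -mulrA (_ : 2 * (4 / rho ^+ 2) = 8 / rho ^+ 2); last by rewrite mulrA -natrM.
  rewrite [leRHS]mulrA [leRHS]mulrAC; apply: ler_wpM2l => //; rewrite divr_ge0 // ltW //.
have PhiB : Phi <= 54 * M.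
  have : 14 * 10 ^+ 3 / rho <= 14 by rewrite ler_pdivrMr //; lra.
  by nra.
have Srho : S <= 55 * rho * M by have : n / 4 <= M / 4; [lra | nra].
have S0 : 0 <= S by apply: sumr_ge0 => v vV; rewrite subr_ge0 degk.
have Sk : S / k <= S / rho ^+ 2.
  by apply: ler_wpM2l => //; rewrite lef_pV2 ?posrE //; lra.
have Srho2 : S / rho ^+ 2 <= 55 / rho * M.
  rewrite ler_pdivrMr //.
  have -> : 55 / rho * M * rho ^+ 2 = 55 * rho * M by field; rewrite gt_eqF.
  by [].
split=> //.
- apply: (@le_trans _ _ (k - rho ^+ 2 / 2)); first by rewrite exprMn exprVn; lra.
  rewrite ler_pdivlMr // /m; have : 0 <= (rho ^+ 2) ^+ 2 by exact: sqr_ge0.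
  by nra.
- by apply: le_trans Vn0; rewrite ler_nat subset_leq_card.
have potE : \sum_(v in V') (b' v + a' v ^+ 2 / (rho / 2) ^+ 2) - 160 * #|V'|%:R =
   \sum_(v in V') (- 160 + b' v) + 4 / rho ^+ 2 * \sum_(v in V') a' v ^+ 2.
  have suma' : \sum_(v in V') a' v ^+ 2 / (rho / 2) ^+ 2 =
               4 / rho ^+ 2 * \sum_(v in V') a' v ^+ 2.
    by rewrite mulr_sumr; apply: eq_bigr => v _; field; rewrite gt_eqF.
  by rewrite !big_split /= suma' sumr_const -[- 160 *+ _]mulr_natr; ring.
have -> : (40 + 14 * 10 ^+ 3 / (rho / 2)) * M =
          (40 + 14 * 10 ^+ 3 / rho) * M + 14 * 10 ^+ 3 / rho * M.
  by field; rewrite gt_eqF.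
(* Lost vertices cost 160 and the variance costs 8 times [S / rho ^+ 2], hence 168. The right side
   is the growth of the allowed potential when [rho] is halved. *)
have : 55 / rho * M * 168 <= 14 * 10 ^+ 3 / rho * M.
  have : 0 <= M / rho by rewrite divr_ge0 // ltW.
  lra.
lra.
Qed.

Lemma iterate_halving N rho M K V w k a b : 10 ^+ 3 <= rho -> 0 <= K -> 0 <= M ->
    rho <= 10 ^+ 3 * 2 ^+ N -> at_scale rho M K V w k a b ->
  exists rho' V' w' k' a' b',
    [/\ 10 ^+ 3 <= rho' <= (2 * 10 ^+ 3), V' \subset V & at_scale rho' M K V' w' k' a' b'].
Proof.
move=> + K0 M0; elim: N rho V w k a b => [|N IHN] rho V w k a b rho1 rhoN st.
  by exists rho, V, w, k, a, b; split=> //; rewrite rho1; move: rhoN; rewrite (expr0 2); lra.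
have [le2|lt2] := leP rho (2 * 10 ^+ 3).
  by exists rho, V, w, k, a, b; split=> //; rewrite rho1.
have [V' [w' [k' [a' [b' [V'V st']]]]]] := halve_scale rho1 K0 M0 st.
have rho2 : 10 ^+ 3 <= rho / 2 by lra.
have rhoN2 : rho / 2 <= 10 ^+ 3 * 2 ^+ N by move: rhoN; rewrite (exprS 2); lra.
have [r [V'' [w'' [k'' [a'' [b'' [? V''V' st'']]]]]]] := IHN _ _ _ _ _ _ rho2 rhoN2 st'.
by exists r, V'', w'', k'', a'', b''; split=> //; exact: subset_trans V'V.
Qed.

(** As [rho] is at least [10 ^+ 3], the potential is at most [54 * M]. The weight 160 then forces
    half of [M] to survive, so [Phi] is at most 108 per vertex, and [2 * 10 ^+ 3] times 108 + 1/4 is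
    below [22 * 10 ^+ 4]. *)
Lemma at_scale_end rho M K V w k a b : 10 ^+ 3 <= rho <= (2 * 10 ^+ 3) -> 0 < M ->
    at_scale rho M K V w k a b ->
  [/\ K / 2 <= k, M / 2 <= #|V|%:R
    & \sum_(v in V) (k - wdegree V w v) <= 22 * 10 ^+ 4 * #|V|%:R].
Proof.
move=> /andP[rho1 rho2] M0 [near kD Vn0 pot].
have rhoge1 : 1 <= rho by lra.
have rho0 : 0 < rho by lra.
have := sum_deficiency_le rhoge1 near; have [_ _ b0 _] := near.
move: pot; set Phi := \sum_(v in V) (b v + _) => pot.
have Phi0 : 0 <= Phi.
  by apply: sumr_ge0 => v vV; rewrite addr_ge0 ?b0 // divr_ge0 ?sqr_ge0.
have r14 : 14 * 10 ^+ 3 / rho * M <= 14 * M.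
  by apply: ler_wpM2r; [exact: ltW | rewrite ler_pdivrMr //; lra].
have nV : M / 2 <= #|V|%:R by lra.
have PhiB : Phi <= 54 * M by lra.
have : rho * (Phi + #|V|%:R / 4) <= (2 * 10 ^+ 3) * (Phi + #|V|%:R / 4).
  by apply: ler_wpM2r => //; rewrite addr_ge0 // divr_ge0.
by have := sqr_ge0 rho; split=> //; lra.
Qed.

End Iteration.

Lemma fractional_nearly_regular (R : realType) (T : finType) (G : graph T) (lambda d : R) :
    1 <= lambda -> 0 < d -> 8 * 10 ^+ 6 * lambda <= d ->
    (forall v, v \in vertices G -> d <= (degree G v)%:R <= lambda * d) ->
  exists (V : {set T}) (w : T -> T -> R) k,
    [/\ [/\ V \subset vertices G, fractional G w & forall v, v \in V -> wdegree V w v <= k],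
      d / lambda / 2 <= k, (num_vertices G)%:R / (4 * lambda) <= #|V|%:R
      & \sum_(v in V) (k - wdegree V w v) <= 22 * 10 ^+ 4 * #|V|%:R].
Proof.
move=> lam1 d0 d_big deg.
have lam0 : 0 < lambda by lra.
have lamN0 : lambda != 0 by rewrite gt_eqF.
have dN0 : d != 0 by rewrite gt_eqF.
pose w u v : R := (adj G u v)%:R.
have w_frac : fractional G w.
  split=> [u v|u v|u v /negPf uv]; rewrite /w; first by rewrite adj_sym.
    by rewrite ler0n lern1 leq_b1.
  by rewrite uv.
have degE v : wdegree (vertices G) w v = (degree G v)%:R.
  rewrite /wdegree /w /degree -sum1_card natr_sum.
  rewrite [LHS](bigID (adj G v)) /= [X in _ + X]big1 ?addr0; last by move=> u /andP[_ /negPf->].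
  apply: eq_big => [u|u /andP[_ ->]] //.
  rewrite inE andbC; case: (boolP (adj G v u)) => //= uv.
  by apply: (@adj_vertices _ G u v); rewrite adj_sym.
have mD : 0 < d <= lambda * d by rewrite d0 ler_peMl // ltW.
have lam_d0 : 0 <= lambda / d by rewrite divr_ge0 // ltW.
have degD v : v \in vertices G -> wdegree (vertices G) w v <= lambda * d.
  by move=> vV; rewrite degE; case/andP: (deg v vV).
(* No degree is below [d], so only charge and variance remain: each vertex contributes at most
   [x v * (-4 + 2 * (1 - x v)) <= -2 * x v]. This bounds [#|V|] from below and the sums of [b] and
   of [a v ^+ 2 / k] by [4 * #|V|]. *)
have := regularizing_step (-4) w_frac mD lam_d0 degD.
set k := d ^+ 2 / (lambda * d).
have kE : k = d / lambda by rewrite /k; field; rewrite ?lamN0 ?dN0.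
move=> [V [w' [a [b [VG near pot]]]]].
have k_big : 2 * 10 ^+ 6 * 4 <= k by rewrite kE ler_pdivlMr //; lra.
have k0 : 0 < k by lra.
have [_ _ b0 _] := near.
pose x v := Num.max (wdegree (vertices G) w v) d / (lambda * d).
have x_ge v : v \in vertices G -> lambda^-1 <= x v.
  move=> vV; rewrite ler_pdivlMr ?mulr_gt0 // mulrA mulVf // mul1r.
  by rewrite le_max lexx orbT.
set n : R := (num_vertices G)%:R.
have sumx : n / lambda <= \sum_(v in vertices G) x v.
  rewrite /n mulr_natl -sumr_const; exact: ler_sum.
have {}pot : \sum_(v in V) (-4 + b v) + k^-1 * \sum_(v in V) a v ^+ 2 <=
             - 2 * (n / lambda).
  have -> : k^-1 = lambda / d by rewrite kE invf_div.
  apply: le_trans pot _.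
  apply: (@le_trans _ _ (\sum_(v in vertices G) (- 2 * x v))); last first.
    by rewrite -mulr_sumr; lra.
  rewrite mulr_sumr -big_split /=; apply: ler_sum => v vV.
  rewrite -/(x v) kE; have -> : 2 * (lambda / d) * (d / lambda) = 2.
    by field; rewrite ?lamN0 ?dN0.
  have -> : Num.max 0 (d - wdegree (vertices G) w v) = 0.
    by apply/max_idPl; rewrite subr_le0 degE; case/andP: (deg v vV).
  by have := sqr_ge0 (x v); lra.
have bsum0 : 0 <= \sum_(v in V) b v by exact: sumr_ge0.
have asum0 : 0 <= k^-1 * \sum_(v in V) a v ^+ 2.
  by apply: mulr_ge0; [rewrite invr_ge0 ltW | apply: sumr_ge0 => v _; exact: sqr_ge0].
have n0 : 0 < n by rewrite ltr0n card_gt0 vertices_neq0.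
have nlam0 : 0 < n / lambda by rewrite divr_gt0.
move: pot; rewrite big_split sumr_const -[-4 *+ _]mulr_natr /= => pot.
have V0 : n / (2 * lambda) <= #|V|%:R.
  by rewrite (_ : n / _ = n / lambda / 2); [lra | field].
have V_gt0 : 0 < (#|V|%:R : R) by apply: lt_le_trans V0; rewrite divr_gt0 ?mulr_gt0.
(* The largest scale satisfying the invariant with [K = k]. *)
pose rho := Num.sqrt (k / 2).
have rho2 : rho ^+ 2 = k / 2 by rewrite sqr_sqrtr // divr_ge0 // ltW.
have rho_ge : 10 ^+ 3 <= rho.
  by rewrite -(ler_pXn2r (n := 2)) ?nnegrE ?sqrtr_ge0 ?exprn_ge0 // rho2; lra.
have rho0 : 0 < rho by lra.
have scale : at_scale G rho #|V|%:R k V w' k a b.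
  split=> //; first by rewrite rho2; lra.
  rewrite subrr mulr0 addr0 big_split /= -mulr_suml rho2 invf_div mulrC.
  have : 0 <= 14 * 10 ^+ 3 / rho * #|V|%:R.
    by rewrite !mulr_ge0 ?exprn_ge0 ?invr_ge0 ?(ltW rho0).
  rewrite mulrDl; lra.
have [N rhoN] : exists N, rho <= 10 ^+ 3 * 2 ^+ N.
  exists (Num.bound rho); apply: (@le_trans _ _ (2 ^+ Num.bound rho)).
    apply: ltW; apply: lt_le_trans (archi_boundP (ltW rho0)) _.
    by rewrite -natrX ler_nat ltnW // ltn_expl.
  by rewrite ler_peMl ?exprn_ge0 //; lra.
have [r [V' [w'' [k' [a' [b' [r_bd V'V scale']]]]]]] :=
  iterate_halving rho_ge (ltW k0) (ltW V_gt0) rhoN scale.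
have [kk' VV' def] := at_scale_end r_bd V_gt0 scale'.
have [[w''_frac degk' _ _] _ _ _] := scale'.
exists V', w'', k'; split=> //.
- by split=> //; exact: subset_trans VG.
- by rewrite -kE.
- by rewrite (_ : n / _ = n / (2 * lambda) / 2); [lra | field].
Qed.

(** * Rounding edge weights to 0 or 1 *)

Section Rounding.
Variables (R : realFieldType).

Lemma kernel_vector (E V : finType) (A : {set E}) (B : {set V}) (c : V -> E -> R) :
    (#|B| < #|A|)%N ->
  exists g : E -> R, [/\ exists e, g e != 0, forall e, e \notin A -> g e = 0
    & forall v, v \in B -> \sum_e g e * c v e = 0].
Proof.
move=> ltBA; pose M := \matrix_(i < #|A|, j < #|B|) c (enum_val j) (enum_val i).
have /rowV0Pn[u /sub_kermxP uM u0] : kermx M != 0.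
  by rewrite -mxrank_eq0 mxrank_ker -lt0n subn_gt0 (leq_ltn_trans (rank_leq_col M)).
pose g e := \sum_i u 0 i * (enum_val i == e)%:R.
have gE i : g (enum_val i) = u 0 i.
  rewrite /g (bigD1 i) //= eqxx mulr1 big1 ?addr0 // => j /negPf ji.
  by rewrite (inj_eq enum_val_inj) ji mulr0.
exists g; split.
- have /rV0Pn[i ui] := u0; exists (enum_val i); by rewrite gE.
- move=> e eA; apply: big1 => i _; case: eqP => [ie|]; last by rewrite mulr0.
  by rewrite -ie enum_valP in eA.
move=> v vB; transitivity ((u *m M) 0 (enum_rank_in vB v)); last by rewrite uM mxE.
rewrite mxE /g; under eq_bigr => e _ do rewrite mulr_suml.
rewrite exchange_big; apply: eq_bigr => i _.
rewrite (bigD1 (enum_val i)) //= eqxx mulr1 big1 ?addr0 => [|e /negPf ei].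
  by rewrite mxE enum_rankK_in.
by rewrite eq_sym ei mulr0 mul0r.
Qed.

(* Beck-Fiala: as long as some value is fractional, the constraints with at
   least three fractional elements are fewer than these elements, so the values
   can be moved along a kernel vector until one more of them is integral; a
   constraint with at most two fractional elements can be dropped. *)
Lemma beck_fiala (E V : finType) (inc : V -> E -> bool) (y : E -> R) :
    (forall e, (#|[set v | inc v e]| <= 2)%N) -> (forall e, 0 <= y e <= 1) ->
  exists2 Z : {set E}, forall e, (y e == 0) || (y e == 1) -> (e \in Z)%:R = y e
    & forall v, `|\sum_(e | inc v e) ((e \in Z)%:R - y e)| <= 2.
Proof.
move=> inc2.
pose frac (y : E -> R) := [set e | 0 < y e < 1].
have nfrac (y' : E -> R) e : 0 <= y' e <= 1 -> e \notin frac y' -> y' e = 0 \/ y' e = 1.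
  rewrite inE => /andP[]; rewrite le_eqVlt => /orP[/eqP<-|->]; first by left.
  by rewrite le_eqVlt => /orP[/eqP->|->] //; right.
have [n] := ubnP #|frac y|; elim: n y => // n IHn y; rewrite ltnS => le_n y01.
pose B := [set v | (2 < #|[set e in frac y | inc v e]|)%N].
have [frac0|/set0Pn[e1 e1F]] := eqVneq (frac y) set0.
  have yE e : y e = (y e == 1)%:R.
    have [||->|->] := nfrac y e => //; rewrite ?frac0 ?inE ?eqxx //.
    by rewrite eq_sym oner_eq0.
  exists [set e | y e == 1] => [e _|v]; first by rewrite inE -yE.
  by rewrite big1 ?normr0 // => e _; rewrite inE -yE subrr.
have ltBF : (#|B| < #|frac y|)%N.
  (* Double counting: each constraint in [B] has at least three fractional elements, and each
     element lies in at most two constraints. *)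
  have : (#|B| * 3 <= #|frac y| * 2)%N.
    rewrite -!sum_nat_const.
    apply: (@leq_trans (\sum_(v in B) \sum_(e in frac y) inc v e)).
      apply: leq_sum => v; rewrite inE => /leq_trans-> //.
      by rewrite -sum1dep_card big_mkcondr; apply: leq_sum => e _ /=; case: (inc v e).
    rewrite exchange_big; apply: leq_sum => e _ /=.
    apply: leq_trans (inc2 e); rewrite -sum1dep_card [leqRHS]big_mkcond [leqLHS]big_mkcond /=.
    by apply: leq_sum => v _; case: (v \in B); case: (inc v e).
  have : (0 < #|frac y|)%N by apply/card_gt0P; exists e1.
  lia.
have [g [[e0 ge0] gF gB]] := kernel_vector (fun v e => (inc v e)%:R) ltBF.
(* How far [y e] can move along [g] within [0, 1]; the minimal such step makes [e2] integral and
   keeps all other values in range. *)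
pose tau e := (if 0 < g e then 1 - y e else y e) / `|g e|.
have [e2 ge2 tau_min] : exists2 e, g e != 0 & forall e', g e' != 0 -> tau e <= tau e'.
  by case: (@arg_minP _ _ _ e0 (fun e => g e != 0) tau ge0) => e ge mine; exists e.
pose y' e := y e + tau e2 * g e.
have tau0 : 0 <= tau e2.
  have /andP[? ?] := y01 e2; apply: divr_ge0 => //.
  by case: ifP => _; rewrite ?subr_ge0.
have y'01 e : 0 <= y' e <= 1.
  have /andP[ye0 ye1] := y01 e; have [ge|ge] := eqVneq (g e) 0.
    by rewrite /y' ge mulr0 addr0 y01.
  have := tau_min e ge; rewrite {2}/tau ler_pdivlMr ?normr_gt0 // /y'.
  by case: (ltrgt0P (g e)) ge => // ge _ h; apply/andP; split; nra.
have y'e2 : e2 \notin frac y'.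
  rewrite inE /y' /tau; case: (ltrgt0P (g e2)) ge2 => // ge _.
    by rewrite divfK ?gt_eqF // addrC subrK ltxx andbF.
  by rewrite invrN mulrN mulNr divfK ?lt_eqF // subrr ltxx.
have y'F e : e \notin frac y -> y' e = y e by move=> /gF ge; rewrite /y' ge mulr0 addr0.
have sub_frac : frac y' \subset frac y.
  apply/subsetP=> e ey'; apply/negPn/negP=> ey.
  by move: (ey) ey'; rewrite !inE y'F // => /negPf->.
have e2F : e2 \in frac y by apply/negPn/negP => /gF /eqP; rewrite (negPf ge2).
have [||Z Z01 ZB] := IHn y' => //.
  apply: leq_trans le_n; apply: proper_card; apply/properP; split=> //.
  by exists e2.
have ZE e : (y e == 0) || (y e == 1) -> (e \in Z)%:R = y e.
  move=> ye; have eF : e \notin frac y.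
    by rewrite inE; case/orP: ye => /eqP->; rewrite ltxx ?andbF.
  by rewrite Z01 y'F.
exists Z => // v; have [vB|vB] := boolP (v \in B).
  (* Moving along [g] does not change the sum over a constraint in [B], so the bound for [y']
     carries over. *)
  rewrite (_ : \sum_(e | inc v e) _ = \sum_(e | inc v e) ((e \in Z)%:R - y' e)) //.
  apply/eqP; rewrite -subr_eq0 -sumrB /=.
  have -> : \sum_(e | inc v e) ((e \in Z)%:R - y e - ((e \in Z)%:R - y' e)) =
            tau e2 * \sum_e g e * (inc v e)%:R.
    rewrite mulr_sumr [LHS]big_mkcond; apply: eq_bigr => e _.
    by rewrite /y'; case: (inc v e) => /=; ring.
  by rewrite gB // mulr0.
(* Integral values of [y] are never changed, so only the at most two fractional elements contribute,
   each at most 1. *)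
apply: le_trans (ler_norm_sum _ _ _) _.
apply: (@le_trans _ _ (\sum_(e in [set e in frac y | inc v e]) 1)); last first.
  by rewrite sumr_const -[_ *+ _]/(_%:R) ler_nat leqNgt; rewrite inE in vB.
rewrite [leLHS]big_mkcond [leRHS]big_mkcond; apply: ler_sum => e _ /=.
rewrite inE; case: (inc v e); rewrite ?andbT ?andbF //.
have /andP[ye0 ye1] := y01 e.
case: (boolP (e \in frac y)) => [_|/(nfrac _ _ (y01 e)) ye].
  by rewrite ler_norml; case: (e \in Z) => /=; apply/andP; split; lra.
by rewrite ZE ?subrr ?normr0 //; case: ye => ->; rewrite eqxx ?orbT.
Qed.
End Rounding.

(** Beck-Fiala with the vertices as constraints and the edges as elements: an edge lies in only two
    constraints. *)
Lemma round_fractional (R : realFieldType) (T : finType) (G : graph T) (V : {set T})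
    (w : T -> T -> R) : fractional G w -> V \subset vertices G -> V != set0 ->
  exists H : graph T, [/\ subgraph H G, vertices H = V
    & forall v, v \in V -> `|(degree H v)%:R - wdegree V w v| <= 2].
Proof.
move=> [w_sym w01 w_adj] VG V0.
(* Each edge is represented by its increasingly ordered pair of endpoints. *)
pose dom (e : T * T) := [&& e.1 \in V, e.2 \in V & (enum_rank e.1 < enum_rank e.2)%N].
pose y e := if dom e then w e.1 e.2 else 0.
pose inc v (e : T * T) := (e.1 == v) || (e.2 == v).
have inc2 e : (#|[set v | inc v e]| <= 2)%N.
  apply: (@leq_trans #|[set e.1; e.2]|); last by rewrite cards2; case: eqP.
  by apply: subset_leq_card; apply/subsetP=> v; rewrite !inE /inc ![_ == v]eq_sym.
have y01 e : 0 <= y e <= 1 by rewrite /y; case: ifP; rewrite ?lexx ?ler01.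
have [Z Z01 ZB] := beck_fiala inc2 y01.
(* Pairs that are wrongly ordered, leave [V] or are not edges have value 0, which rounding
   preserves. *)
have Zdom u v : (u, v) \in Z -> dom (u, v) && adj G u v.
  move=> uvZ; have := Z01 (u, v); rewrite uvZ /y; case: (dom (u, v)) => /=.
    have [//|uv] := boolP (adj G u v); rewrite w_adj // eqxx => /(_ isT) /eqP.
    by rewrite oner_eq0.
  by rewrite eqxx => /(_ isT) /eqP; rewrite oner_eq0.
pose h u v := ((u, v) \in Z) || ((v, u) \in Z).
have h_sym : symmetric h by move=> u v; rewrite /h orbC.
have h_adj : subrel h (adj G).
  move=> u v /orP[] /Zdom /andP[_] //; by rewrite adj_sym.
have h_irr : irreflexive h.
  by move=> u; apply/negP => /h_adj; rewrite adj_irrefl.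
have h_V u v : h u v -> u \in V.
  by case/orP => /Zdom /andP[] /and3P[].
exists (Graph h_sym h_irr h_V V0); split=> // v vV.
pose f e : R := (e \in Z)%:R - y e.
have f0 u u' : (enum_rank u' <= enum_rank u)%N -> f (u, u') = 0.
  move=> le_u; have ndom : dom (u, u') = false by rewrite /dom /= ltnNge le_u !andbF.
  by rewrite /f Z01 /y ndom ?eqxx // subrr.
(* The vanishing of [F] on the diagonal prevents [(v, v)] from being counted twice. *)
have sumE (F : T * T -> R) : (forall u u', (enum_rank u' <= enum_rank u)%N -> F (u, u') = 0) ->
    \sum_(e | inc v e) F e = \sum_u (F (v, u) + F (u, v)).
  move=> F0; rewrite big_split big_mkcond /=.
  transitivity (\sum_e ((if e.1 == v then F (e.1, e.2) else 0) +
                        (if e.2 == v then F (e.1, e.2) else 0))).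
    apply: eq_bigr => -[u u'] _; rewrite /inc /=.
    case: eqP => [->|_]; case: eqP => [->|_] /=; rewrite ?addr0 ?add0r //.
    by rewrite F0 // addr0.
  rewrite big_split /=; congr (_ + _).
    rewrite -(pair_bigA _ (fun u u' => if u == v then F (u, u') else 0)) /=.
    by rewrite exchange_big; apply: eq_bigr => u _; rewrite -big_mkcond big_pred1_eq.
  rewrite -(pair_bigA _ (fun u u' => if u' == v then F (u, u') else 0)) /=.
  by apply: eq_bigr => u _; rewrite -big_mkcond big_pred1_eq.
have := ZB v; rewrite (sumE f f0); congr (`|_| <= _).
rewrite /degree -sum1dep_card natr_sum [X in _ = X - _]big_mkcond /wdegree
  [X in _ = _ - X]big_mkcond -sumrB.
apply: eq_bigr => u _ /=.
have -> : (if h v u then 1%:R else 0 : R) = ((v, u) \in Z)%:R + ((u, v) \in Z)%:R.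
  rewrite /h; have [vu|_] /= := boolP ((v, u) \in Z); last by case: ifP; rewrite add0r.
  have [uv|_] /= := boolP ((u, v) \in Z); last by rewrite addr0.
  have /andP[/and3P[_ _ /= h1] _] := Zdom _ _ vu.
  by have /andP[/and3P[_ _ /= h2] _] := Zdom _ _ uv; lia.
suff -> : (if u \in V then w v u else 0) = y (v, u) + y (u, v) by rewrite /f; ring.
rewrite /y /dom /= vV; case: (u \in V) => /=; last by rewrite addr0.
case: ltngtP => [_|_|/ord_inj/enum_rank_inj->]; rewrite ?addr0 ?add0r //.
by rewrite w_adj // adj_irrefl.
Qed.

(** * Maximal matchings *)

Lemma maximal_matching (T : finType) (G : graph T) (D : nat) :
    (forall v, v \in vertices G -> 0 < degree G v <= D)%N ->
  exists H : graph T, [/\ subgraph H G, forall v, v \in vertices H -> degree H v = 1%N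
    & (num_vertices G <= num_vertices H * D.+1)%N].
Proof.
move=> degG.
(* A matching is encoded as a symmetric set of ordered pairs that is the graph of a partial
   function. *)
pose P (M : {set T * T}) := [forall e in M, adj G e.1 e.2 && ((e.2, e.1) \in M)] &&
   [forall e in M, forall f in M, (e.1 == f.1) ==> (e.2 == f.2)].
have P0 : P set0 by apply/andP; split; apply/forall_inP => e; rewrite inE.
have [M /maxsetP[/andP[/forall_inP Madj /forall_inP Minj] Mmax] _] := maxset_exists P0.
pose U := [set u | [exists v, (u, v) \in M]].
have inU u v : (u, v) \in M -> u \in U by move=> uv; rewrite inE; apply/existsP; exists v.
pose h u v := (u, v) \in M.
have hP u v : h u v -> adj G u v && h v u by move/Madj.
have cover u v : adj G u v -> (u \in U) || (v \in U).
  apply: contraLR; rewrite negb_or => /andP[uU vU]; apply/negP => uv.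
  have MU a b : (a, b) \in M -> [&& a != u, a != v, b != u & b != v].
    move=> ab; have /andP[_ /= ba] := Madj _ ab; have aU := inU _ _ ab; have bU := inU _ _ ba.
    by rewrite -!negb_or; apply/negP => /or4P[] /eqP E; move: aU bU;
       rewrite E ?(negPf uU) ?(negPf vU).
  have uv_neq : u != v by apply: contraTneq uv => ->; rewrite adj_irrefl.
  (* An edge avoiding [U] could be added in both orientations, contradicting maximality. *)
  have ME : (u, v) |: ((v, u) |: M) = M.
    apply: Mmax; last by apply/subsetP => e eM; rewrite !inE eM !orbT.
    apply/andP; split; apply/forall_inP => e; rewrite !inE.
      case/or3P => [/eqP->|/eqP->|eM] /=; rewrite ?uv ?eqxx ?orbT //.
        by rewrite adj_sym uv.
      by have /andP[-> ->] := Madj e eM; rewrite !orbT.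
    move=> eM; apply/forall_inP => f; rewrite !inE => fM; apply/implyP.
    case/or3P: eM fM => [/eqP->|/eqP->|eM] /or3P[/eqP->|/eqP->|fM] //=.
    + by rewrite (negPf uv_neq).
    + by case: f fM => a b /MU /and4P[/negPf au _ _ _] /=; rewrite eq_sym au.
    + by rewrite eq_sym (negPf uv_neq).
    + by case: f fM => a b /MU /and4P[_ /negPf av _ _] /=; rewrite eq_sym av.
    + by case: e eM => a b /MU /and4P[/negPf au _ _ _] /=; rewrite au.
    + by case: e eM => a b /MU /and4P[_ /negPf av _ _] /=; rewrite av.
    + by apply/implyP; have /forall_inP := Minj _ eM; apply.
  by move: uU; rewrite (inU u v) // -ME !inE eqxx.
have h_sym : symmetric h by move=> u v; apply/idP/idP => /hP /andP[].
have h_irr : irreflexive h by move=> u; apply/negP => /hP; rewrite adj_irrefl.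
have h_U u v : h u v -> u \in U by exact: inU.
have nbr v : v \in vertices G -> exists u, adj G v u.
  by move=> /degG /andP[/card_gt0P[u]]; rewrite inE => vu _; exists u.
have U0 : U != set0.
  have /set0Pn[v /nbr[u /cover]] := vertices_neq0 G.
  by case/orP => ?; apply/set0Pn; [exists v | exists u].
have UG : U \subset vertices G.
  by apply/subsetP=> u; rewrite inE => /existsP[v /hP /andP[/adj_vertices]].
exists (Graph h_sym h_irr h_U U0); split=> [|v /=|].
- by split=> // u v /hP /andP[].
- rewrite inE => /existsP[u vu]; rewrite /degree (_ : [set _ | _] = [set u]) ?cards1 //.
  apply/setP=> u'; rewrite !inE; apply/idP/eqP => [vu'|->] //.
  by have /forall_inP/(_ _ vu)/implyP/(_ (eqxx _))/eqP := Minj _ vu'.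
rewrite /num_vertices /= -sum1_card -sum_nat_const.
(* Every vertex lies in [U] or has a neighbour there, while each [u] in [U] accounts for itself and
   at most [D] neighbours. *)
apply: (@leq_trans (\sum_(v in vertices G) \sum_(u in U) ((u == v) + adj G u v))%N).
  apply: leq_sum => v vG.
  have [vU|vU] := boolP (v \in U); first by rewrite (bigD1 v vU) /= eqxx -addnA.
  have [u vu] := nbr v vG; have := cover _ _ vu; rewrite (negPf vU) /= => uU.
  by rewrite (bigD1 u uU) /= adj_sym vu addn1.
rewrite exchange_big; apply: leq_sum => u uU /=; have uG := subsetP UG u uU.
rewrite big_split /= -add1n leq_add //.
  rewrite (bigD1 u uG) /= eqxx big1 // => v /andP[_ /negPf vu].
  by rewrite eq_sym vu.
have /andP[_] := degG u uG; apply: leq_trans.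
rewrite /degree -sum1dep_card [leqLHS]big_mkcond [leqRHS]big_mkcond /=.
by apply: leq_sum => v _; case: (v \in _); case: (adj G u v).
Qed.

(** * The cases of bounded and of large [d / lambda] *)

Theorem theorem2p1 (R : realType) :
  exists c : R, 0 < c /\
    forall (lambda d : R), 1 <= lambda -> 0 < d ->
    forall (T : finType) (G : graph T),
      (forall v, v \in vertices G ->
         d <= (degree G v)%:R /\ (degree G v)%:R <= lambda * d) ->
      exists d' : R, c * d / lambda ^+ 3 <= d' /\
        exists H : graph T,
          [/\ subgraph H G,
              average_degree R H = d',
              (max_degree H)%:R <= d' + 10 ^+ 8
            & c * (num_vertices G)%:R / lambda ^+ 10 <= (num_vertices H)%:R].
Proof.
exists (10 ^+ 8)^-1; split; first by rewrite invr_gt0 exprn_gt0.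
move=> lambda d lam1 d0 T G deg.
have lam0 : 0 < lambda by lra.
have lamN0 : lambda != 0 by rewrite gt_eqF.
set C : R := 10 ^+ 8.
have C0 : 0 < C by rewrite exprn_gt0.
have n0 (H : graph T) : 0 < (num_vertices H)%:R :> R.
  by rewrite ltr0n card_gt0 vertices_neq0.
(* As [lambda >= 1], proving a bound with a smaller power of [lambda] suffices. *)
have bound (s t : R) m n : 0 <= t -> (m <= n)%N -> s <= t * (C * lambda ^+ m) ->
    C^-1 * s / lambda ^+ n <= t.
  move=> t0 mn st; rewrite ler_pdivrMr ?exprn_gt0 // mulrC ler_pdivrMr // -mulrA.
  apply: le_trans st _; apply: ler_wpM2l => //; rewrite mulrC.
  by apply: ler_wpM2r; [exact: ltW | exact: ler_weXn2l].
have max_le (H : graph T) (B : R) : 0 <= B ->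
    (forall v, v \in vertices H -> (degree H v)%:R <= B) -> (max_degree H)%:R <= B.
  move=> B0 HB; rewrite /max_degree; elim/big_ind: _ => // a b aB bB.
  by rewrite /maxn; case: ifP.
have [small|big] := ltP d (8 * 10 ^+ 6 * lambda).
  have degG v : v \in vertices G -> (0 < degree G v <= max_degree G)%N.
    move=> vG; have [dv _] := deg v vG; apply/andP; split.
      by rewrite -(ltr0n R); exact: lt_le_trans dv.
    exact: leq_bigmax_cond.
  have maxG : (max_degree G)%:R <= lambda * d.
    by apply: max_le => [|v /deg[]//]; rewrite mulr_ge0 // ltW.
  have [H [HG degH leH]] := maximal_matching degG.
  exists 1; split.
    apply: (@bound _ _ 1%N) => //; rewrite expr1 mul1r.
    by apply: le_trans (ltW small) _; rewrite ler_pM2r // /C; lra.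
  exists H; split=> //.
  - rewrite /average_degree (eq_bigr (fun=> 1%N)) // sum1_card divff //.
    by rewrite gt_eqF ?n0.
  - have C1 : 0 <= 1 + C :> R by lra.
    by apply: (max_le _ _ C1) => v /degH ->; lra.
  apply: (@bound _ _ 2) => //.
  move: leH; rewrite -(ler_nat R) natrM => /le_trans-> //.
  rewrite ler_pM2l // -addn1 natrD.
  have lam2 : 1 <= lambda ^+ 2 by rewrite exprn_ege1.
  have : lambda * d <= lambda * (8 * 10 ^+ 6 * lambda) by rewrite ler_pM2l // ltW.
  by rewrite mulrCA -expr2 /C; lra.
have degG v : v \in vertices G -> d <= (degree G v)%:R <= lambda * d.
  by move=> /deg[-> ->].
have [V [w [k [[VG w_frac degk] kd nV def]]]] := fractional_nearly_regular lam1 d0 big degG.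
have V_gt0 : 0 < (#|V|%:R : R).
  by apply: lt_le_trans nV; rewrite divr_gt0 ?n0 ?mulr_gt0.
have V0 : V != set0 by rewrite -card_gt0 -(ltr0n R).
have [H [HG HV degH]] := round_fractional w_frac VG V0.
have k_big : 4 * 10 ^+ 6 <= k.
  by apply: le_trans kd; rewrite !ler_pdivlMr //; lra.
have nH : num_vertices H = #|V| by rewrite /num_vertices HV.
(* The mean deficiency [22 * 10 ^+ 4] and the rounding error 2 add up to less than
   [23 * 10 ^+ 4]. *)
have avg : k - 23 * 10 ^+ 4 <= average_degree R H.
  rewrite /average_degree nH ler_pdivlMr // natr_sum HV.
  apply: (@le_trans _ _ (\sum_(v in V) (k - (k - wdegree V w v) - 2))).
    rewrite [leRHS]sumrB [X in _ <= X - _]sumrB !sumr_const -[k *+ _]mulr_natr.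
    by rewrite -[2 *+ _]mulr_natr; lra.
  apply: ler_sum => v vV; have := degH v vV; rewrite ler_norml => /andP[]; lra.
exists (average_degree R H); split.
  apply: le_trans avg; apply: (@bound _ _ 1%N) => //; first by lra.
  rewrite expr1; have : d <= 2 * k * lambda.
    by move: kd; rewrite -mulrA -invfM ler_pdivrMr ?mulr_gt0 //; lra.
  move/le_trans; apply; rewrite mulrA ler_pM2r // /C.
  apply: (@le_trans _ _ ((k - 23 * 10 ^+ 4) * 10)); first by lra.
  by apply: ler_wpM2l; lra.
exists H; split=> //.
  have avg0 : 0 <= average_degree R H + 10 ^+ 8 by lra.
  apply: (max_le _ _ avg0) => v; rewrite HV => vV.
  by have := degH v vV; have := degk v vV; rewrite ler_norml => ? /andP[]; lra.
rewrite nH; apply: (@bound _ _ 1%N) => //.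
rewrite expr1; move: nV; rewrite ler_pdivrMr ?mulr_gt0 // => /le_trans; apply.
by rewrite ler_pM2l // ler_pM2r // /C; lra.
Qed.
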